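(* Let $F$ be a field. Say that a finite uniform layered graph $\Gamma=(V,E)$ without multiple edges is of type $(\dagger)$ if $V=\coprod_{i=0}^3V_i$, $\Gamma$ has exactly one minimal vertex, all minimal vertices of $\Gamma$ are contained in $V_0$, $V_3=\{a\}$ is a single vertex, and $a>b$ for every $b\in V_2$. (1) Let $\Gamma$ be of type $(\dagger)$ and set $r=|V_+|$ and $s=|E_2|-1$. Then $r\ge3$, $r-3\le s\le -1+(r-1)^2/4$, and the Hilbert series of $B(\Gamma)$ is $$h(B(\Gamma),\tau)=1+r\tau+s\tau^2+(s-r+3)\tau^3.$$ (2) Conversely, if $r,s\in\mathbb{Z}$ satisfy $r\ge3$ and $r-3\le s\le-1+(r-1)^2/4$, then there is a graph $\Gamma$ of type $(\dagger)$ with $r=|V_+|$ and $s=|E_2|-1$.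
   Context: Layered graphs: $\Gamma=(V,E)$ is a directed graph; for $e\in E$, $t(e)$ is its tail and $h(e)$ its head (the edge goes from $t(e)$ to $h(e)$). $\Gamma$ is layered if $V=\coprod_{i=0}^N V_i$ and, writing $|v|=i$ (the level of $v$) for $v\in V_i$, one has $|t(e)|=|h(e)|+1$ for every $e\in E$. $V$ is regarded as a poset: $u>v$ iff there is a directed path (with at least one edge) from $u$ to $v$. $E_i$ denotes the set of edges with tail in $V_i$, and $V_+=\coprod_{i>0}V_i$. Uniform: vertices $v,v'$ of the same level $i>0$ are connected by a down-up sequence if there are $v=v_0,v_1,\dots,v_k=v'$ in $V_i$ and $w_1,\dots,w_k\in V_{i-1}$ with $w_j<v_{j-1}$ and $w_j<v_j$ for $j=1,\dots,k$ (a vertex is connected to itself by the sequence with $k=0$). $\Gamma$ is uniform if for any two edges $e,e'$ with $t(e)=t(e')$, the heads $h(e),h(e')$ are connected by a down-up sequence $v_0,\dots,v_k$ with $v_j<t(e)$ for all $j$. The algebra $B(\Gamma)$: for $v\in V_+$ let $S(v)$ be the set of vertices $w$ such that there is an edge from $v$ to $w$. $B(\Gamma)$ is the associative unital $F$-algebra generated by the vertices $v\in V_+$ with relations (i) $u\cdot v=0$ for $u,v\in V_+$ if there is no edge from $u$ to $v$; (ii) $v\cdot\sum_{w\in S(v)}w=0$ for every $v$ with $|v|>1$. It is graded with each generator in degree 1, and $h(B,\tau)=\sum_n\dim(B_n)\tau^n$.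
   Formalization: Part (1) also assumes that all maximal vertices lie in V_3, i.e. every vertex of V_1 is the head of an edge; without it r-3≤s and the Hilbert series can fail (V_2={b}, V_1={w,w'}, only w below b). The graphs built in (2) satisfy it too. *)

(* Defs.v *)
From HB Require Import structures.
From mathcomp Require Import all_boot all_order all_algebra.
From mathcomp Require Import generic_quotient.
From mathcomp Require Import boolp.
From mathcomp Require Import finmap monalg.

Set Implicit Arguments.
Unset Strict Implicit.
Unset Printing Implicit Defensive.

Import GRing.Theory.

Local Open Scope quotient_scope.
Local Open Scope ring_scope.

(* [src e] and [tgt e] are the tail and the head of the edge [e], and [level v]
   is |v|.  Since the vertex set is finite, boundedness of the levels is automatic. *)
Record layeredGraph := LayeredGraph {
  vertex :> finType;
  edge : finType;
  src : edge -> vertex;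
  tgt : edge -> vertex;
  level : vertex -> nat;
  level_src : forall e : edge, level (src e) = (level (tgt e)).+1
}.

Arguments edge : clear implicits.
Arguments src {l}.
Arguments tgt {l}.
Arguments level {l}.

Section LayeredGraphTheory.

Variable G : layeredGraph.

Definition adj : rel G :=
  [rel u v | [exists e : edge G, (src e == u) && (tgt e == v)]].

(* The order of the poset [G]: [above u v] is "u > v". *)
Definition above (u v : G) : Prop :=
  exists2 p : seq G, p != [::] & path adj u p && (last u p == v).

Definition minimal (v : G) : Prop := forall u : G, ~ above v u.

Definition maximal (v : G) : Prop := forall u : G, ~ above u v.

Definition no_multiple_edges : Prop :=
  injective (fun e : edge G => (src e, tgt e)).

(* [v 0, ..., v k] in level [i] and [w 1, ..., w k] in level [i - 1]; values
   outside these ranges are irrelevant.  For [i = 0] only [k = 0] is possible. *)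
Definition down_up (i k : nat) (v w : nat -> G) : Prop :=
  [/\ forall j, (j <= k)%N -> level (v j) = i,
      forall j, (1 <= j <= k)%N -> (level (w j)).+1 = i
    & forall j, (1 <= j <= k)%N -> above (v j.-1) (w j) /\ above (v j) (w j)].

Definition uniform : Prop :=
  forall e e' : edge G, src e = src e' ->
  exists k (v w : nat -> G),
    [/\ v 0%N = tgt e, v k = tgt e', down_up (level (tgt e)) k v w
      & forall j, (j <= k)%N -> above (src e) (v j)].

Definition Vplus := {v : G | (0 < level v)%N}.

Definition E_ (i : nat) : {set edge G} := [set e | level (src e) == i].

Definition dagger : Prop :=
  [/\ uniform /\ no_multiple_edges,
      forall v : G, (level v <= 3)%N,
      exists! v : G, minimal v,
      forall v : G, minimal v -> level v = 0%N
    & exists2 a : G, forall v : G, level v = 3 <-> v = a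
                   & forall b : G, level b = 2 -> above a b].

(* Given [dagger], this only says that every vertex of level 1 is below some
   vertex.  Without it, the Hilbert series can fail to be the one determined by
   [#|V_+|] and [#|E_2|]: each vertex of level 1 that is not the head of an edge
   adds 1 to the dimension of [B_3]. *)
Definition maximal_in_top : Prop := forall v : G, maximal v -> level v = 3.

End LayeredGraphTheory.

Arguments adj {G}.

Lemma malg_scalerAr (F : fieldType) (K : monomType) (c : F)
  (x y : {malg F[K]}) : c *: (x * y) = x * (c *: y).
Proof.
apply/malgP => k; rewrite mcoeffZ mcoeffMl mulr_sumr.
rewrite (mcoeffMlw _ (fsubset_refl _) (msuppZ_le c y)).
apply: eq_bigr => i _; rewrite mulr_sumr; apply: eq_bigr => j _.
by rewrite mcoeffZ mulrnAr mulrCA.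
Qed.

(* The free algebra on [I] is the monoid algebra of the free monoid on [I]. *)
Section PresentedAlgebra.

Variables (F : fieldType) (I : choiceType).

Local Notation T := {malg F[{fmonom I}]}.

Definition free_gen (i : I) : T := << fmu i >>.

Variable R : T -> Prop.

Definition two_sided_ideal (J : T -> Prop) : Prop :=
  [/\ J 0, forall x y, J x -> J y -> J (x - y)
    & forall a x b, J x -> J (a * x * b)].

Definition rel_ideal (x : T) : Prop :=
  forall J, two_sided_ideal J -> (forall y, R y -> J y) -> J x.

Lemma rel_ideal_two_sided : two_sided_ideal rel_ideal.
Proof.
split; first by move=> J [].
  move=> x y Jx Jy J iJ RJ; have [_ JB _] := iJ.
  by apply: JB; [apply: Jx|apply: Jy].
move=> a x b Jx J iJ RJ; have [_ _ JM] := iJ.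
exact/JM/(Jx J iJ RJ).
Qed.

Lemma rel_ideal0 : rel_ideal 0.
Proof. by have [J0 _ _] := rel_ideal_two_sided; exact: J0. Qed.

Lemma rel_idealB x y : rel_ideal x -> rel_ideal y -> rel_ideal (x - y).
Proof. by have [_ JB _] := rel_ideal_two_sided; exact: JB. Qed.

Lemma rel_idealN x : rel_ideal x -> rel_ideal (- x).
Proof. by move=> Jx; rewrite -sub0r; exact: rel_idealB rel_ideal0 Jx. Qed.

Lemma rel_idealD x y : rel_ideal x -> rel_ideal y -> rel_ideal (x + y).
Proof.
by move=> Jx Jy; rewrite -[y]opprK; exact: rel_idealB Jx (rel_idealN Jy).
Qed.

Lemma rel_idealMl a x : rel_ideal x -> rel_ideal (a * x).
Proof.
by have [_ _ JM] := rel_ideal_two_sided; rewrite -[a * x]mulr1; exact: JM.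
Qed.

Lemma rel_idealMr x b : rel_ideal x -> rel_ideal (x * b).
Proof.
have [_ _ JM] := rel_ideal_two_sided.
by rewrite -[x in x * b]mul1r; exact: JM.
Qed.

Lemma rel_idealZ (c : F) x : rel_ideal x -> rel_ideal (c *: x).
Proof. by move=> Jx; rewrite -[x]mul1r scalerAl; apply: rel_idealMl. Qed.

Definition rel_eqv (x y : T) : bool := `[< rel_ideal (x - y) >].

Lemma rel_eqv_refl : reflexive rel_eqv.
Proof. by move=> x; apply/asboolP; rewrite subrr; apply: rel_ideal0. Qed.

Lemma rel_eqv_sym : symmetric rel_eqv.
Proof.
by move=> x y; apply/asboolP/asboolP => /rel_idealN; rewrite opprB.
Qed.

Lemma rel_eqv_trans : transitive rel_eqv.
Proof.
move=> y x z /asboolP Jxy /asboolP Jyz; apply/asboolP.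
by rewrite -(subrKA y); apply: rel_idealD.
Qed.

Canonical rel_eqv_equiv :=
  EquivRel rel_eqv rel_eqv_refl rel_eqv_sym rel_eqv_trans.

(* The F-algebra with generators [I] and relations [x = 0] for [R x]. *)
Definition presented := {eq_quot rel_eqv}.

HB.instance Definition _ := Choice.on presented.
HB.instance Definition _ := EqQuotient.on presented.

Definition proj (x : T) : presented := \pi_{eq_quot rel_eqv} x.

Lemma presented_eqP (x y : T) :
  reflect (proj x = proj y) `[< rel_ideal (x - y) >].
Proof. exact: (@eqmodP _ rel_eqv_equiv x y). Qed.

Lemma reprpK (x : presented) : proj (repr x) = x.
Proof. exact: (@reprK _ {eq_quot rel_eqv} x). Qed.

Definition pzero : presented := proj 0.
Definition pone : presented := proj 1.
Definition popp (x : presented) : presented := proj (- repr x).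
Definition padd (x y : presented) : presented := proj (repr x + repr y).
Definition pmul (x y : presented) : presented := proj (repr x * repr y).
Definition pscale (c : F) (x : presented) : presented := proj (c *: repr x).

Lemma repr_congr (x : T) : rel_ideal (repr (proj x) - x).
Proof. by apply/asboolP/presented_eqP; rewrite reprpK. Qed.

Lemma poppE (x : T) : popp (proj x) = proj (- x).
Proof.
apply/presented_eqP/asboolP; rewrite -opprD.
apply: rel_idealN; exact: repr_congr.
Qed.

Lemma paddE (x y : T) : padd (proj x) (proj y) = proj (x + y).
Proof.
apply/presented_eqP/asboolP; rewrite opprD addrACA.
by apply: rel_idealD; apply: repr_congr.
Qed.

Lemma pmulE (x y : T) : pmul (proj x) (proj y) = proj (x * y).
Proof.
apply/presented_eqP/asboolP; set x' := repr _; set y' := repr _.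
rewrite -(subrKA (x' * y)) -mulrBr -mulrBl.
apply: rel_idealD; [apply: rel_idealMl|apply: rel_idealMr];
  exact: repr_congr.
Qed.

Lemma pscaleE (c : F) (x : T) : pscale c (proj x) = proj (c *: x).
Proof.
apply/presented_eqP/asboolP; rewrite -scalerBr.
apply: rel_idealZ; exact: repr_congr.
Qed.

Let piP (x : presented) : {y : T | x = proj y}.
Proof. by exists (repr x); rewrite reprpK. Qed.

Fact paddA : associative padd.
Proof.
move=> x y z; case: (piP x) (piP y) (piP z) => [{}x ->] [{}y ->] [{}z ->].
by rewrite !paddE addrA.
Qed.

Fact paddC : commutative padd.
Proof.
move=> x y; case: (piP x) (piP y) => [{}x ->] [{}y ->].
by rewrite !paddE addrC.
Qed.

Fact padd0 : left_id pzero padd.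
Proof. by move=> x; case: (piP x) => [{}x ->]; rewrite paddE add0r. Qed.

Fact paddN : left_inverse pzero popp padd.
Proof.
by move=> x; case: (piP x) => [{}x ->]; rewrite poppE paddE addNr.
Qed.

HB.instance Definition _ :=
  GRing.isZmodule.Build presented paddA paddC padd0 paddN.

Fact pmulA : associative pmul.
Proof.
move=> x y z; case: (piP x) (piP y) (piP z) => [{}x ->] [{}y ->] [{}z ->].
by rewrite !pmulE mulrA.
Qed.

Fact pmul1l : left_id pone pmul.
Proof. by move=> x; case: (piP x) => [{}x ->]; rewrite pmulE mul1r. Qed.

Fact pmul1r : right_id pone pmul.
Proof. by move=> x; case: (piP x) => [{}x ->]; rewrite pmulE mulr1. Qed.

Fact pmulDl : left_distributive pmul padd.
Proof.
move=> x y z; case: (piP x) (piP y) (piP z) => [{}x ->] [{}y ->] [{}z ->].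
by rewrite !(pmulE, paddE) mulrDl.
Qed.

Fact pmulDr : right_distributive pmul padd.
Proof.
move=> x y z; case: (piP x) (piP y) (piP z) => [{}x ->] [{}y ->] [{}z ->].
by rewrite !(pmulE, paddE) mulrDr.
Qed.

HB.instance Definition _ := GRing.Zmodule_isPzRing.Build presented
  pmulA pmul1l pmul1r pmulDl pmulDr.

Fact pscaleA (c d : F) (x : presented) :
  pscale c (pscale d x) = pscale (c * d) x.
Proof. by case: (piP x) => [{}x ->]; rewrite !pscaleE scalerA. Qed.

Fact pscale1 : left_id 1 pscale.
Proof. by move=> x; case: (piP x) => [{}x ->]; rewrite pscaleE scale1r. Qed.

Fact pscaleDr : right_distributive pscale padd.
Proof.
move=> c x y; case: (piP x) (piP y) => [{}x ->] [{}y ->].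
by rewrite !(pscaleE, paddE) scalerDr.
Qed.

Fact pscaleDl (x : presented) (c d : F) :
  pscale (c + d) x = padd (pscale c x) (pscale d x).
Proof.
by case: (piP x) => [{}x ->]; rewrite !(pscaleE, paddE) scalerDl.
Qed.

HB.instance Definition _ := GRing.Zmodule_isLmodule.Build F presented
  pscaleA pscale1 pscaleDr pscaleDl.

Lemma proj0 : proj 0 = 0.
Proof. by []. Qed.

Lemma proj1 : proj 1 = 1.
Proof. by []. Qed.

Lemma projD (x y : T) : proj (x + y) = proj x + proj y.
Proof. exact/esym/paddE. Qed.

Lemma projN (x : T) : proj (- x) = - proj x.
Proof. exact/esym/poppE. Qed.

Lemma projM (x y : T) : proj (x * y) = proj x * proj y.
Proof. exact/esym/pmulE. Qed.

Lemma projZ (c : F) (x : T) : proj (c *: x) = c *: proj x.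
Proof. exact/esym/pscaleE. Qed.

Lemma presented_scalerAl (c : F) (x y : presented) :
  c *: (x * y) = (c *: x) * y.
Proof.
case: (piP x) (piP y) => [{}x ->] [{}y ->].
by rewrite -!(projZ, projM) scalerAl.
Qed.

Lemma presented_scalerAr (c : F) (x y : presented) :
  c *: (x * y) = x * (c *: y).
Proof.
case: (piP x) (piP y) => [{}x ->] [{}y ->].
by rewrite -!(projZ, projM) malg_scalerAr.
Qed.

Definition gen (i : I) : presented := proj (free_gen i).

End PresentedAlgebra.

(* For a linear subspace [S]: [e] is a basis of [S] with [d] elements. *)
Definition has_dim (F : fieldType) (M : lmodType F) (S : M -> Prop) (d : nat) : Prop :=
  exists2 e : 'I_d -> M, forall i, S (e i) &
    forall x, S x -> exists! c : {ffun 'I_d -> F}, x = \sum_(i < d) c i *: e i.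

Section AlgebraB.

Variables (F : fieldType) (G : layeredGraph).

Local Notation T := {malg F[{fmonom (Vplus G)}]}.
Local Notation X := (free_gen F).

Inductive relB : T -> Prop :=
| RelNoEdge (u v : Vplus G) : ~~ adj (val u) (val v) -> relB (X u * X v)
| RelSum (v : Vplus G) : (1 < level (val v))%N ->
    relB (X v * \sum_(w : Vplus G | adj (val v) (val w)) X w).

Definition algB := presented relB.

HB.instance Definition _ := GRing.PzRing.on algB.
HB.instance Definition _ := GRing.Lmodule.on algB.

Fact algB_nonzero : (1 : algB) != 0.
Proof.
apply/eqP => e; have /asboolP := introT (presented_eqP relB 1 0) e.
rewrite subr0 => /(_ (fun x : T => x@_mone = 0)) H.
have /eqP : (1 : T)@_mone = 0.
  apply: H.
    split=> [|x y x0 y0|a x b x0]; rewrite ?raddf0 ?raddfB /= ?x0 ?y0 ?subrr //.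
    by rewrite !rmorphM /= x0 mulr0 mul0r.
  have X0 u : (X u)@_mone = 0.
    by rewrite mcoeffU1; case: eqP => // /(congr1 (@fdeg _)); rewrite fdegU fdeg1.
  by move=> y [u v _|v _]; rewrite rmorphM /= X0 mul0r.
by rewrite rmorph1 oner_eq0.
Qed.

HB.instance Definition _ := GRing.PzSemiRing_isNonZero.Build algB algB_nonzero.
HB.instance Definition _ := GRing.Lmodule_isLalgebra.Build F algB
  (@presented_scalerAl _ _ relB).
HB.instance Definition _ := GRing.Lalgebra_isAlgebra.Build F algB
  (@presented_scalerAr _ _ relB).

Definition genB (v : Vplus G) : algB := gen relB v.

Definition gradeB (n : nat) (x : algB) : Prop :=
  exists c : n.-tuple (Vplus G) -> F,
    x = \sum_(t : n.-tuple (Vplus G)) c t *: \prod_(v <- t) genB v.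

(* [h(B(G), tau)], as a formal power series, is the polynomial [h]. *)
Definition hilbert_series_is (h : {poly int}) : Prop :=
  forall n, exists2 d : nat, has_dim (gradeB n) d & h`_n = d%:Z.

End AlgebraB.

(* Main.v *)
From HB Require Import structures.
Require Import Defs.
From mathcomp Require Import all_boot all_order all_algebra.
From mathcomp Require Import boolp finmap monalg zify lra.

Set Implicit Arguments.
Unset Strict Implicit.
Unset Printing Implicit Defensive.

Import GRing.Theory Num.Theory.
Local Open Scope ring_scope.

(** A graph of type dagger is a single top vertex [a] joined to all of layer 2,
    a single bottom vertex below all of layer 1, and a bipartite graph between
    layers 2 and 1.  Uniformity applied to the edges leaving [a] says that this
    bipartite graph is connected.  Write [n1], [n2] for the sizes of the two
    layers and [E] for the number of edges between them, so that
    [r = n1 + n2 + 1] and [s = E - 1].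

    The degree [n] part of [B] is spanned by the words of length [n] that are
    directed paths in [V_+], and the relations among them are spanned by the
    sums of [s1 v w s2] over the [w] below [v].  That there are no further
    relations is seen by duality: a function on words that vanishes on
    non-paths and is orthogonal to these sums defines a linear functional on
    the free algebra that kills the whole ideal
    ([word_functional_rel_ideal]).  Hence [dim B_n] is the number of paths minus
    the rank of the matrix of these relations ([has_dim_gradeB]).

    In degree 2 there are [n2 + E] paths and [n2 + 1] independent relations.
    In degree 3 the paths are [a b c] with [b c] one of the [E] edges, and the
    relation matrix is the incidence matrix of the bipartite graph: a vector in
    its left kernel changes sign along each edge, so by connectedness the left
    kernel is a line and the rank is [n1 + n2 - 1].  There is no path of length
    4 or more.  This gives the Hilbert series; since a rank is at most the
    number of columns it also gives [n1 + n2 - 1 <= E], which is the lower bound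
    on [s], while the upper bound is [E <= n1 n2 <= (n1 + n2)^2 / 4].

    Conversely, split [r - 1] into two halves as even as possible and add
    edges to a double star until the required number is reached; the centres of
    the double star provide all the down-up sequences. *)

(** * Functionals on the free algebra *)

(** For an additive [g], the elements [x] with [g (a * x * b) = 0] for all [a] and
    [b] form a two-sided ideal. *)
Lemma annihilatorB (A : pzRingType) (M : zmodType) (g : {additive A -> M}) a x y b :
  g (a * x * b) = 0 -> g (a * y * b) = 0 -> g (a * (x - y) * b) = 0.
Proof. by move=> gx gy; rewrite mulrBr mulrBl raddfB gx gy subrr. Qed.

Lemma annihilatorM (A : pzRingType) (M : zmodType) (g : {additive A -> M}) a x b c d :
  (forall a b, g (a * x * b) = 0) -> g (c * (a * x * b) * d) = 0.
Proof. by move=> gx; rewrite !mulrA -mulrA gx. Qed.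

Lemma annihilator_suml (A : pzRingType) (M : zmodType) (g : {additive A -> M})
    (J : Type) (r : seq J) (E : J -> A) x b :
  (forall i, g (E i * x * b) = 0) -> g ((\sum_(i <- r) E i) * x * b) = 0.
Proof. by move=> gE; rewrite !mulr_suml raddf_sum big1. Qed.

Lemma annihilator_sumr (A : pzRingType) (M : zmodType) (g : {additive A -> M})
    (J : Type) (r : seq J) (E : J -> A) x a :
  (forall i, g (a * x * E i) = 0) -> g (a * x * \sum_(i <- r) E i) = 0.
Proof. by move=> gE; rewrite mulr_sumr raddf_sum big1. Qed.

Section WordFunctionals.


Variables (F : fieldType) (I : choiceType).
Local Notation T := {malg F[{fmonom I}]}.
Implicit Types (f : seq I -> F) (s : seq I).

Definition word s : T := \prod_(i <- s) free_gen F i.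

(** The linear extension of [f] from words to the free algebra. *)
Definition word_functional f : T -> F := mmap idfun (fun m : {fmonom I} => f m).

Fact word_functional_is_additive f : additive (word_functional f).
Proof. exact: (@raddfB _ _ (mmap idfun (fun m : {fmonom I} => f m))). Qed.

HB.instance Definition _ f :=
  GRing.isAdditive.Build T F (word_functional f) (word_functional_is_additive f).

Lemma wordE s : word s = << FMonom s >>.
Proof.
rewrite /word; elim: s => [|i s IHs].
  rewrite big_nil; apply/malgP => k; rewrite mcoeff1 mcoeffU1 eq_sym.
  by rewrite !fmP fm1.
rewrite big_cons IHs malgM_def fgmulUU mulr1.
by congr << _ *g _ >>; apply/eqP; rewrite fmP fmM fmU.
Qed.

Lemma word_functional_word f s : word_functional f (word s) = f s.
Proof. by rewrite wordE /word_functional mmapU mul1r. Qed.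

Lemma word_functionalZ f c x :
  word_functional f (c *: x) = c * word_functional f x.
Proof.
rewrite /word_functional (mmapEw (msuppZ_le _ _)) mmapE mulr_sumr.
by apply: eq_bigr => m _; rewrite mcoeffZ mulrA.
Qed.

Lemma malg_word_expansion (x : T) :
  x = \sum_(m <- msupp x) x@_m *: word (m : {fmonom I}).
Proof.
rewrite {1}[x]monalgE; apply: eq_bigr => m _.
rewrite wordE; apply/malgP => k; rewrite mcoeffZ !mcoeffU.
by rewrite mulr_natr; case: m.
Qed.

Lemma malg_scale_sandwich c d (u y v : T) :
  (c *: u) * y * (d *: v) = (c * d) *: (u * y * v).
Proof.
rewrite -(@scalerAl F T c u y) -(@scalerAl F T c (u * y)) -scalerA.
by congr (_ *: _); apply/esym/malg_scalerAr.
Qed.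

(** It suffices to test the functional on relations multiplied by words on both
    sides, since words span the free algebra. *)
Lemma word_functional_rel_ideal (R : T -> Prop) f :
    (forall y s1 s2, R y -> word_functional f (word s1 * y * word s2) = 0) ->
  forall x, rel_ideal R x -> word_functional f x = 0.
Proof.
move=> fR x Jx; pose J (x : T) := forall a b, word_functional f (a * x * b) = 0.
suffices /(_ 1 1): J x by rewrite mul1r mulr1.
apply: Jx => [|y Ry a b].
  split=> [a b|y z Jy Jz a b|a y b Jy c d]; first by rewrite mulr0 mul0r raddf0.
    exact: (annihilatorB (Jy a b) (Jz a b)).
  exact (@annihilatorM T F (word_functional f) a y b c d Jy).
rewrite (malg_word_expansion a); apply: (@annihilator_suml T F (word_functional f)) => m.
rewrite (malg_word_expansion b); apply: (@annihilator_sumr T F (word_functional f)) => k.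
by rewrite malg_scale_sandwich; apply: etrans (word_functionalZ f _ _) _; rewrite fR ?mulr0.
Qed.

End WordFunctionals.

(** * Dimensions of quotients *)

Section LinearAlgebra.

Variable F : fieldType.

(** [S] is the quotient of the free space on [P] by the row space of [A]: the
    second hypothesis says that the rows are relations between the [e p], and
    the third, by duality, that they span all relations.  A complement of the
    row space then maps isomorphically onto [S]. *)
Lemma has_dim_quotient (M : lmodType F) (S : M -> Prop) (P Q : finType)
    (e : P -> M) (A : Q -> P -> F) :
    (forall x, S x <-> exists c : P -> F, x = \sum_p c p *: e p) ->
    (forall q, \sum_p A q p *: e p = 0) ->
    (forall c f : P -> F, \sum_p c p *: e p = 0 ->
      (forall q, \sum_p A q p * f p = 0) -> \sum_p c p * f p = 0) ->
  has_dim S (#|P| - \rank (\matrix_(i < #|Q|, j < #|P|)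
                              A (enum_val i) (enum_val j))).
Proof.
move=> Sspan Arel Aperp; set B := (\matrix_(i, j) _ : 'M_(#|Q|, #|P|)).
pose comb (c : 'rV[F]_#|P|) := \sum_j c 0 j *: e (enum_val j).
have reindex_P (V : zmodType) (h : P -> V) :
    \sum_p h p = \sum_(j < #|P|) h (enum_val j).
  exact: (big_enum_val h).
have combE (c : P -> F) :
    \sum_p c p *: e p = comb (\row_j c (enum_val j)).
  by rewrite /comb reindex_P; apply: eq_bigr => j _; rewrite mxE.
have comb_rV c : comb c = \sum_p c 0 (enum_rank p) *: e p.
  by rewrite combE; congr comb; apply/rowP => j; rewrite mxE enum_valK.
have combD c d : comb (c + d) = comb c + comb d.
  by rewrite -big_split; apply: eq_bigr => j _; rewrite mxE scalerDl.
have combZ a c : comb (a *: c) = a *: comb c.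
  by rewrite /comb scaler_sumr; apply: eq_bigr => j _; rewrite mxE scalerA.
have comb0 : comb 0 = 0 by apply: big1 => j _; rewrite mxE scale0r.
have combB c d : comb (c - d) = comb c - comb d.
  by rewrite -(scaleN1r d) combD combZ scaleN1r.
have comb_sum n (c : 'I_n -> 'rV_#|P|) : comb (\sum_i c i) = \sum_i comb (c i).
  exact: (big_morph _ combD comb0).
(* The third hypothesis is applied to the columns of the cokernel of [B], whose
   common kernel is the row space. *)
have comb_ker c : comb c = 0 <-> (c <= B)%MS.
  split=> [c0|/submxP[d ->]]; last first.
    rewrite mulmx_sum_row comb_sum big1 // => i _.
    rewrite combZ (_ : comb _ = 0) ?scaler0 //.
    rewrite -(Arel (enum_val i)) combE; congr comb.
    by apply/rowP => j; rewrite !mxE.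
  rewrite submxE; apply/eqP/rowP => k; rewrite mxE [RHS]mxE.
  pose f p := cokermx B (enum_rank p) k.
  have f0 q : \sum_p A q p * f p = 0.
    have /matrixP/(_ (enum_rank q) k) := mulmx_coker B; rewrite mxE [RHS]mxE; apply: etrans.
    rewrite reindex_P; apply: eq_bigr => j _.
    by rewrite mxE /f enum_rankK enum_valK.
  have := Aperp (fun p => c 0 (enum_rank p)) f _ f0.
  rewrite -comb_rV c0 => /(_ erefl); apply: etrans.
  by rewrite reindex_P; apply: eq_bigr => j _; rewrite /f enum_valK.
rewrite -mxrank_compl; set N := row_base (B^C)%MS.
exists (fun i => comb (row i N)) => [i|x].
  by apply/Sspan; exists (fun p => row i N 0 (enum_rank p)); rewrite comb_rV.
have combN (c : 'I_(\rank (B^C)%MS) -> F) :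
    \sum_i c i *: comb (row i N) = comb (\row_i c i *m N).
  rewrite mulmx_sum_row comb_sum; apply: eq_bigr => i _.
  by rewrite combZ mxE.
move=> /Sspan[c ->]; rewrite combE; set v := \row_j _.
have /sub_addsmxP[[v1 v2] /= vE] : (v <= B + N)%MS.
  rewrite (adds_eqmx (eqmx_refl B) (eq_row_base _)) submx_full //.
  exact: addsmx_compl_full.
have v1_0 : comb (v1 *m B) = 0 by apply/comb_ker/submxMl.
exists [ffun i => v2 0 i]; split=> [|d].
  rewrite combN vE combD v1_0 add0r; congr comb; congr (_ *m _).
  by apply/rowP => i; rewrite mxE ffunE.
rewrite combN vE combD v1_0 add0r => eq_comb.
have : (v2 *m N - \row_i d i *m N <= B :&: N)%MS.
  rewrite sub_capmx -mulmxBl submxMl andbT; apply/comb_ker.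
  by rewrite mulmxBl combB eq_comb subrr.
rewrite (cap_eqmx (eqmx_refl B) (eq_row_base _)) capmx_compl submx0 -mulmxBl.
rewrite -(mul0mx _ N) (inj_eq (row_free_inj (row_base_free _))) subr_eq0 => /eqP ->.
by apply/ffunP => i; rewrite ffunE mxE.
Qed.

Lemma mxrank_ker_line m n (A : 'M[F]_(m, n)) (z : 'rV_m) :
    z != 0 -> z *m A = 0 -> (forall y : 'rV_m, y *m A = 0 -> (y <= z)%MS) ->
  \rank A = m.-1.
Proof.
move=> z0 zA Az; have kerz : (kermx A :=: z)%MS.
  apply/eqmxP; rewrite sub_kermx zA eqxx andbT; apply/row_subP => i.
  by apply: Az; apply/eqP; rewrite -sub_kermx row_sub.
have := mxrank_ker A; rewrite kerz rank_rV z0 => m1.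
by have := rank_leq_row A; lia.
Qed.

End LinearAlgebra.

Section WordProducts.

Variables (A : pzRingType) (I : finType) (h : I -> A).

Lemma prod_insert_pair s1 u v s2 :
  \prod_(i <- s1) h i * (h u * h v) * \prod_(i <- s2) h i
    = \prod_(i <- s1 ++ [:: u, v & s2]) h i.
Proof. by rewrite big_cat !big_cons /= !mulrA. Qed.

Lemma prod_insert_sum s1 v (p : pred I) s2 :
  \prod_(i <- s1) h i * (h v * \sum_(w | p w) h w) * \prod_(i <- s2) h i
    = \sum_(w | p w) \prod_(i <- s1 ++ [:: v, w & s2]) h i.
Proof.
rewrite mulr_sumr mulr_sumr mulr_suml; apply: eq_bigr => w _.
exact: prod_insert_pair.
Qed.

End WordProducts.

(** * The graded pieces of B as quotients of spaces of paths *)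

Section GradedPieces.

Variables (F : fieldType) (G : layeredGraph).
Local Notation W := (Vplus G).
Local Notation X := (free_gen F).

Definition adjV : rel W := fun u v => adj (val u) (val v).

Definition wordB (s : seq W) : algB F G := \prod_(v <- s) genB F v.

Definition path_tuple n := {t : n.-tuple W | sorted adjV t}.

Lemma wordB_proj s : wordB s = proj (@relB F G) (word F s).
Proof.
rewrite /wordB /word; elim: s => [|v s IHs]; first by rewrite !big_nil proj1.
by rewrite !big_cons projM IHs.
Qed.

Lemma genB_no_edge u v : ~~ adjV u v -> genB F u * genB F v = 0.
Proof.
move=> uv; rewrite /genB /gen -[LHS]projM -[RHS]proj0.
by apply/presented_eqP/asboolP; rewrite subr0 => J _; apply; apply: RelNoEdge.
Qed.

Lemma genB_sum v : (1 < level (val v))%N ->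
  genB F v * \sum_(w | adjV v w) genB F w = 0.
Proof.
move=> v1; rewrite /genB /gen.
have -> : \sum_(w | adjV v w) (proj (@relB F G) (X w) : algB F G)
    = proj (@relB F G) (\sum_(w | adjV v w) X w).
  by rewrite (big_morph _ (@projD _ _ _) (@proj0 _ _ _)).
rewrite -[LHS]projM -[RHS]proj0.
by apply/presented_eqP/asboolP; rewrite subr0 => J _; apply; apply: RelSum.
Qed.

Lemma wordB_not_path s : ~~ sorted adjV s -> wordB s = 0.
Proof.
case: s => [//|u s] /=; elim: s u => [//|v s IHs] u /=.
rewrite negb_and => /orP[uv|/IHs vs0].
  by rewrite /wordB !big_cons mulrA genB_no_edge // mul0r.
by rewrite /wordB big_cons [X in _ * X]vs0 mulr0.
Qed.

Lemma wordB_relation s1 v s2 : (1 < level (val v))%N ->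
  \sum_(w | adjV v w) wordB (s1 ++ [:: v, w & s2]) = 0.
Proof. by move=> v1; rewrite -prod_insert_sum genB_sum // mulr0 mul0r. Qed.

Lemma sum_path_tuple (M : zmodType) n (g : n.-tuple W -> M) :
    (forall t : n.-tuple W, ~~ sorted adjV t -> g t = 0) ->
  \sum_t g t = \sum_(t : path_tuple n) g (val t).
Proof.
move=> g0; rewrite (bigID (fun t : n.-tuple W => sorted adjV t)) /=.
by rewrite [X in _ + X]big1 // addr0 -big_sub.
Qed.

Lemma gradeB_path n x : gradeB n x <->
  exists c : path_tuple n -> F, x = \sum_t c t *: wordB (val t).
Proof.
split=> [[c ->]|[c ->]].
  exists (fun t => c (val t)); rewrite sum_path_tuple // => t tN.
  by rewrite [X in _ *: X]wordB_not_path ?scaler0.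
exists (fun t => if insub t is Some p then c p else 0).
rewrite sum_path_tuple => [|t tN]; first by apply: eq_bigr => t _; rewrite valK.
by rewrite [X in _ *: X]wordB_not_path ?scaler0.
Qed.

(** The words occurring in the relation [s1 * v * \sum_w w * s2], where
    [r = (s1, v, s2)]. *)
Definition relation_row (r : seq W * W * seq W) : pred (seq W) :=
  fun s => [exists w, adjV r.1.2 w && (s == r.1.1 ++ [:: r.1.2, w & r.2])].

Lemma sum_relation_row (M : zmodType) (g : seq W -> M) n s1 v s2 :
    (forall s, ~~ sorted adjV s -> g s = 0) -> (size s1 + size s2).+2 = n ->
  \sum_(t : path_tuple n | relation_row (s1, v, s2) (val t)) g (val t)
    = \sum_(w | adjV v w) g (s1 ++ [:: v, w & s2]).
Proof.
move=> g0 sz_n.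
have sz w : size (s1 ++ [:: v, w & s2]) == n.
  by rewrite size_cat /= !addnS sz_n.
have nth_w w : nth v (s1 ++ [:: v, w & s2]) (size s1).+1 = w.
  by rewrite nth_cat ltnNge leqnSn /= subSnn.
pose g' (t : n.-tuple W) := if relation_row (s1, v, s2) t then g t else 0.
rewrite big_mkcond -(sum_path_tuple (g := g')).
  rewrite -big_mkcond.
  rewrite (reindex_onto (fun w => Tuple (sz w)) (fun t => nth v t (size s1).+1)) /=.
    apply: eq_bigl => w; rewrite nth_w eqxx andbT.
    apply/existsP/idP => [[w' /= /andP[vw /eqP E]]|vw]; last by exists w; rewrite vw eqxx.
    by rewrite -(nth_w w) E nth_w.
  by move=> t /existsP[w /= /andP[_ /eqP tE]]; apply: val_inj; rewrite /= tE nth_w.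
by move=> t /g0 gt; rewrite /g'; case: ifP.
Qed.

(** The indices [q] list the relations [(s1, v, s2)] in degree [n].  The list may
    omit those whose words are not paths, because they hold trivially. *)
Theorem has_dim_gradeB n (Q : finType) (r : Q -> seq W * W * seq W) :
    (forall q, (1 < level (val (r q).1.2))%N /\
               (size (r q).1.1 + size (r q).2).+2 = n) ->
    (forall s1 v w s2, (1 < level (val v))%N -> (size s1 + size s2).+2 = n ->
       sorted adjV (s1 ++ [:: v, w & s2]) -> exists q, r q = (s1, v, s2)) ->
  has_dim (gradeB n (F := F) (G := G))
    (#|{: path_tuple n}| - \rank (\matrix_(i < #|Q|, j < #|{: path_tuple n}|)
        (relation_row (r (enum_val i)) (val (enum_val j)))%:R : 'M[F]_(_, _))).
Proof.
move=> rP r_all.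
apply: (@has_dim_quotient _ _ _ {: path_tuple n} Q (fun t => wordB (val t))
         (fun q t => (relation_row (r q) (val t))%:R)) => [x|q|c f c0 f0].
- exact: gradeB_path.
- under eq_bigr do rewrite scaler_nat mulrb.
  rewrite -big_mkcond; case: (r q) (rP q) => [[s1 v] s2] [/= v1 sz].
  by rewrite sum_relation_row ?wordB_relation //; exact: wordB_not_path.
(* Extend [f] by zero to a function [f'] on all words. *)
pose f' s := \sum_(t : path_tuple n | tval (val t) == s) f t.
have f'E t : f' (tval (val t)) = f t.
  by rewrite /f' (big_pred1 t) // => t'; rewrite !val_eqE.
have f'N s : ~~ sorted adjV s -> f' s = 0.
  by move=> sN; apply: big1 => t /eqP st; move: sN; rewrite -st (valP t).
have f'sz s : size s != n -> f' s = 0.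
  by move=> sN; apply: big1 => t /eqP st; move: sN; rewrite -st size_tuple eqxx.
have : rel_ideal (@relB F G) (\sum_t c t *: word F (val t)).
  rewrite -[X in rel_ideal _ X]subr0; apply/asboolP/presented_eqP.
  rewrite proj0 -[RHS]c0 (big_morph _ (@projD _ _ _) (@proj0 _ _ _)).
  by apply: eq_bigr => t _; rewrite projZ wordB_proj.
have word_f (J : finType) (P : pred J) (E : J -> seq W) :
    word_functional f' (\sum_(j | P j) word F (E j)) = \sum_(j | P j) f' (E j).
  by rewrite raddf_sum; apply: eq_bigr => j _; rewrite -word_functional_word.
have word_fZ : word_functional f' (\sum_t c t *: word F (val t)) = \sum_t c t * f t.
  rewrite raddf_sum; apply: eq_bigr => t _.
  by apply: etrans (word_functionalZ f' _ _) _; rewrite word_functional_word f'E.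
rewrite -word_fZ; apply: word_functional_rel_ideal => _ s1 s2 [u v uv|v v1].
  rewrite /word prod_insert_pair -[X in word_functional _ X]/(word F _).
  rewrite word_functional_word f'N //; apply: contra uv.
  by move=> /cat_sorted2[_ /= /andP[]].
rewrite /word prod_insert_sum -[X in word_functional _ X]/(\sum_(w | _) word F _) word_f.
have [sz|szN] := eqVneq (size s1 + size s2).+2 n; last first.
  by apply: big1 => w _; rewrite f'sz // size_cat /= !addnS.
have [|/existsPn sN] := boolP [exists w, sorted adjV (s1 ++ [:: v, w & s2])]; last first.
  by apply: big1 => w _; rewrite f'N.
move=> /existsP[w /(r_all _ _ _ _ v1 sz)[q rq]].
rewrite -(sum_relation_row _ f'N sz) -[RHS](f0 q) [LHS]big_mkcond /= rq.
by apply: eq_bigr => t _; rewrite f'E mulr_natl mulrb.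
Qed.

End GradedPieces.

(** * Layered graphs *)

Section LayeredGraphs.

Variable G : layeredGraph.
Implicit Types u v w : G.

Lemma adj_level u v : adj u v -> level u = (level v).+1.
Proof. by case/existsP=> e /andP[/eqP <- /eqP <-]; exact: level_src. Qed.

Lemma path_level u p : path adj u p -> level u = (level (last u p) + size p)%N.
Proof.
elim: p u => [|v p IHp] u /=; first by rewrite addn0.
by case/andP=> /adj_level -> /IHp ->; rewrite addnS.
Qed.

Lemma above_level u v : above u v -> (level v < level u)%N.
Proof.
case=> p p0 /andP[/path_level -> /eqP ->]; rewrite -[X in (X < _)%N]addn0 ltn_add2l.
by rewrite lt0n size_eq0.
Qed.

Lemma adj_above u v : adj u v -> above u v.
Proof. by move=> uv; exists [:: v]; rewrite //= uv eqxx. Qed.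

Lemma above_adj u v : above u v -> level u = (level v).+1 -> adj u v.
Proof.
case=> [[//|w [|x p]] _ /andP[up /eqP uv]] lu; first by move: up uv => /= /andP[uw _] <-.
by have := path_level up; rewrite uv lu /=; lia.
Qed.

Lemma above_out u v : above u v -> exists w, adj u w.
Proof. by case=> [[//|w p] _ /= /andP[/andP[uw _] _]]; exists w. Qed.

Lemma above_in u v : above u v -> exists w, adj w v.
Proof.
case=> p; case/lastP: p => [//|p w] _; rewrite rcons_path last_rcons.
by case/andP=> /andP[_ pw] /eqP <-; exists (last u p).
Qed.

Lemma level0_minimal v : level v = 0%N -> minimal v.
Proof. by move=> v0 u /above_level; rewrite v0. Qed.

Lemma minimalPn v : ~ minimal v -> exists w, adj v w.
Proof.
move=> nmin; apply: contra_notP nmin => nadj u /above_out [w vw].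
by apply: nadj; exists w.
Qed.

Lemma maximalPn v : ~ maximal v -> exists w, adj w v.
Proof.
move=> nmax; apply: contra_notP nmax => nadj u /above_in [w wv].
by apply: nadj; exists w.
Qed.

Definition layer i : {set G} := [set v | level v == i].

Lemma card_E_adj i : no_multiple_edges G ->
  #|E_ G i| = #|[set uv : G * G | adj uv.1 uv.2 & level uv.1 == i]|.
Proof.
move=> inj; rewrite -(card_imset _ inj); apply: eq_card => -[u v].
rewrite !inE /=; apply/imsetP/andP => [[e] | [/existsP[e /andP[/eqP eu /eqP ev]] ui]].
  rewrite inE => ei [-> ->]; split=> //.
  by apply/existsP; exists e; rewrite !eqxx.
by exists e; rewrite ?inE eu ?ev.
Qed.

Lemma path_tuple_small n : (n <= 1)%N -> #|{: path_tuple G n}| = (#|{: Vplus G}| ^ n)%N.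
Proof.
move=> n1; rewrite -card_tuple card_sig; apply: eq_card => t.
have: (size t <= 1)%N by rewrite size_tuple.
by rewrite !inE; case: (tval t) => [|u [|v s]].
Qed.

Lemma tuple_path_level n (t : path_tuple G n) :
  (0 < n)%N -> exists v : Vplus G, (n <= level (val v))%N.
Proof.
case: t => t /= st n0; have: (0 < size t)%N by rewrite size_tuple.
rewrite -{2}(size_tuple t); case: (tval t) st => [//|u s] /= st _.
exists u; have := @path_level (val u) (map val s).
rewrite path_map => /(_ st) ->.
rewrite last_map size_map -add1n leq_add2r.
exact: (valP (last u s)).
Qed.

End LayeredGraphs.

(** * Graphs of type dagger *)

Section DaggerGraphs.

Variables (F : fieldType) (G : layeredGraph).
Hypotheses (dG : dagger G) (mG : maximal_in_top G).

Let level_le3 (v : G) : (level v <= 3)%N.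
Proof. by case: dG. Qed.

Let no_mult : no_multiple_edges G.
Proof. by case: dG => -[]. Qed.

Lemma dagger_out (v : G) : (0 < level v)%N -> exists w, adj v w.
Proof.
move=> v0; apply: minimalPn => vmin; case: dG => _ _ _ /(_ v vmin) E _.
by rewrite E in v0.
Qed.

Lemma dagger_in (v : G) : (level v < 3)%N -> exists w, adj w v.
Proof. by move=> v3; apply: maximalPn => /mG E; rewrite E in v3. Qed.

Lemma dagger_top : exists a : Vplus G, [/\ level (val a) = 3%N,
  forall v : G, level v = 3%N -> v = val a &
  forall b : G, adj (val a) b = (level b == 2)%N].
Proof.
case: dG => _ _ _ _ [a aP ab]; have a3 : level a = 3%N by apply/aP.
have a0 : (0 < level a)%N by rewrite a3.
exists (Sub a a0); split=> //= [v /aP //|b].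
apply/idP/eqP => [/adj_level|b2]; first by rewrite a3 => -[].
by apply: above_adj; [exact: ab|rewrite a3 b2].
Qed.

Local Notation n1 := #|layer G 1|.
Local Notation n2 := #|layer G 2|.

Lemma card_layer3 : #|layer G 3| = 1%N.
Proof.
have [a [a3 aU _]] := dagger_top.
apply/eqP/cards1P; exists (val a); apply/setP => v; rewrite !inE.
by apply/eqP/eqP => [/aU //|->].
Qed.

Lemma layer2_neq0 : (0 < n2)%N.
Proof.
have [a [a3 _ _]] := dagger_top.
have [|b] := @dagger_out (val a); first by rewrite a3.
move/adj_level; rewrite a3 => -[b2]; apply/card_gt0P; exists b.
by rewrite inE -b2.
Qed.

Lemma layer1_neq0 : (0 < n1)%N.
Proof.
have /card_gt0P[b] := layer2_neq0; rewrite inE => /eqP b2.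
have [|c] := @dagger_out b; first by rewrite b2.
move/adj_level; rewrite b2 => -[c1]; apply/card_gt0P; exists c.
by rewrite inE -c1.
Qed.

(** Vertices are counted layer by layer; layer 3 contributes a single vertex. *)
Lemma card_levels (p : pred nat) :
  #|[pred v : G | p (level v)]| =
    (p 0 * #|layer G 0| + p 1 * n1 + p 2 * n2 + p 3)%N.
Proof.
have layerE i : #|layer G i| = (\sum_(v : G) (level v == i))%N.
  by rewrite -sum1_card big_mkcond; apply: eq_bigr => v _; rewrite inE; case: eqP.
rewrite [X in (_ + X)%N](_ : _ = p 3 * #|layer G 3|)%N; last first.
  by rewrite card_layer3 muln1.
rewrite !layerE !big_distrr -!big_split /=.
rewrite -sum1_card big_mkcond; apply: eq_bigr => v _ /=.
rewrite inE; have := level_le3 v.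
by case: (level v) => [|[|[|[|]]]] //= _; rewrite ?muln0 ?muln1 ?addn0 ?add0n; case: (p _).
Qed.

Lemma card_Vplus : #|{: Vplus G}| = (n1 + n2 + 1)%N.
Proof. by rewrite card_sig (card_levels (fun i => 0 < i)%N) /= !mul1n. Qed.

Lemma card_Vplus_level (p : pred nat) : ~~ p 0 ->
  #|{: {v : Vplus G | p (level (val v))}}| = (p 1 * n1 + p 2 * n2 + p 3)%N.
Proof.
move=> p0; have := card_levels p; rewrite (negbTE p0) mul0n add0n => <-.
rewrite card_sig -(card_imset _ val_inj); apply: eq_card => v; rewrite inE.
apply/imsetP/idP => [[x] | pv]; first by rewrite inE => px ->.
have v0 : (0 < level v)%N by case: (level v) pv => //; rewrite (negbTE p0).
by exists (Sub v v0); rewrite ?inE.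
Qed.

Lemma card_E2_le : (#|E_ G 2| <= n2 * n1)%N.
Proof.
rewrite card_E_adj // -cardsX; apply/subset_leq_card/subsetP => -[u v].
rewrite !inE /= => /andP[/adj_level uv /eqP u2]; rewrite u2 eqxx /=.
by move: uv; rewrite u2 => -[<-].
Qed.

Lemma card_E3 : #|E_ G 3| = n2.
Proof.
have [a [a3 aU aE]] := dagger_top.
rewrite card_E_adj //; have inj : injective (fun b : G => (val a, b)) by move=> b c [].
rewrite -(card_imset _ inj); apply: eq_card => -[u v]; rewrite !inE /=.
apply/andP/imsetP => [[uv /eqP /aU u_a]|[b]].
  by exists v; rewrite ?inE ?u_a // -aE -u_a.
by rewrite inE -aE => ab [-> ->]; rewrite ab a3.
Qed.

(** A path of length 2 in [V_+] is an edge leaving layer 2 or layer 3. *)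
Lemma card_path_tuple2 : #|{: path_tuple G 2}| = (#|E_ G 2| + n2)%N.
Proof.
rewrite -card_E3 !card_E_adj //.
have disj : [set uv : G * G | adj uv.1 uv.2 & level uv.1 == 2%N]
    :&: [set uv : G * G | adj uv.1 uv.2 & level uv.1 == 3%N] = set0.
  apply/setP => -[u v]; rewrite !inE /=; apply/negP.
  by case/andP=> /andP[_ /eqP ->] /andP[].
rewrite -cardsUI disj cards0 addn0.
pose f (t : path_tuple G 2) := (val (tnth (val t) ord0), val (tnth (val t) ord_max)).
have f_inj : injective f.
  move=> s t [/val_inj E0 /val_inj E1]; apply: val_inj; apply: eq_from_tnth => i.
  case: i => -[|[|//]] i2; first by rewrite [Ordinal _](_ : _ = ord0) //; apply: val_inj.
  by rewrite [Ordinal _](_ : _ = ord_max) //; apply: val_inj.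
rewrite -cardsT -(card_imset _ f_inj); apply: eq_card => -[u v]; rewrite !inE /=.
apply/imsetP/idP => [[[[[|x [|y [|]]] //= sz] st] _ [-> ->]]|].
  move: st; rewrite /= andbT => xy; rewrite /tnth /= -andb_orr [adj _ _]xy /=.
  have := level_le3 (val x); rewrite (adj_level xy); have := valP y.
  by move: (level _) => [|[|[|]]].
rewrite -andb_orr => /andP[uv u23].
have u0 : (0 < level u)%N by case/orP: u23 => /eqP ->.
have v0 : (0 < level v)%N by move: u23; rewrite (adj_level uv); case: (level v).
have st : sorted (@adjV G) [tuple (Sub u u0 : Vplus G); Sub v v0] by rewrite /= andbT.
by exists (Sub [tuple (Sub u u0 : Vplus G); Sub v v0] st).
Qed.

Lemma path3P (x y z : Vplus G) : sorted (@adjV G) [:: x; y; z] ->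
  [/\ adj (val x) (val y), adj (val y) (val z),
      level (val x) = 3%N, level (val y) = 2%N & level (val z) = 1%N].
Proof.
rewrite /= andbT => /andP[xy yz]; split=> //.
- have := adj_level xy; have := adj_level yz; have := level_le3 (val x); have := valP z.
  by rewrite /=; lia.
- have := adj_level xy; have := adj_level yz; have := level_le3 (val x); have := valP z.
  by rewrite /=; lia.
have := adj_level xy; have := adj_level yz; have := level_le3 (val x); have := valP z.
by rewrite /=; lia.
Qed.

(** A path of length 3 in [V_+] starts at the top vertex, hence is determined by
    its last edge. *)
Lemma card_path_tuple3 : #|{: path_tuple G 3}| = #|E_ G 2|.
Proof.
have [a [a3 aU aE]] := dagger_top.
rewrite card_E_adj //.
pose f (t : path_tuple G 3) :=
  (val (nth a (val t) 1), val (nth a (val t) 2)).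
have f_inj : injective f.
  move=> [[[|x [|y [|z [|]]]] // sz] st] [[[|x' [|y' [|z' [|]]]] // sz'] st'].
  rewrite /f /= => -[/val_inj Ey /val_inj Ez]; do 2!apply: val_inj => /=.
  rewrite Ey Ez; congr (_ :: _); apply: val_inj.
  by have [_ _ /aU -> _ _] := path3P st; have [_ _ /aU -> _ _] := path3P st'.
rewrite -cardsT -(card_imset _ f_inj); apply: eq_card => -[u v]; rewrite !inE /=.
apply/imsetP/andP => [[[[[|x [|y [|z [|]]]] // sz] st] _ [-> ->]]|[uv /eqP u2]].
  by have [_ yz _ /= -> _] := path3P st.
have u0 : (0 < level u)%N by rewrite u2.
have v0 : (0 < level v)%N by have := adj_level uv; rewrite u2 => -[<-].
have st : sorted (@adjV G) [tuple a; (Sub u u0 : Vplus G); Sub v v0].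
  by rewrite /= andbT /adjV /= aE u2 eqxx.
by exists (Sub [tuple a; (Sub u u0 : Vplus G); Sub v v0] st).
Qed.

Lemma path_tuple_large n : (3 < n)%N -> #|{: path_tuple G n}| = 0%N.
Proof.
move=> n3; apply: eq_card0 => t.
have [|v nv] := tuple_path_level t; first by case: (n) n3.
by have := level_le3 (val v); rewrite leqNgt (leq_trans n3 nv).
Qed.

Lemma has_dim_gradeB_free n :
    (forall s1 (v w : Vplus G) s2, (1 < level (val v))%N ->
       (size s1 + size s2).+2 = n -> ~~ sorted (@adjV G) (s1 ++ [:: v, w & s2])) ->
  has_dim (gradeB n (F := F) (G := G)) #|{: path_tuple G n}|.
Proof.
move=> no_rel.
have := @has_dim_gradeB F G n void (of_void _) (fun q => match q with end).
set A := (\matrix_(i, j) _); have -> : \rank A = 0%N.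
  by apply/eqP; rewrite -leqn0 (leq_trans (rank_leq_row _)) // card_void.
rewrite subn0; apply => s1 v w s2 v1 sz st.
by have := no_rel s1 v w s2 v1 sz; rewrite st.
Qed.

(** There is one relation for each [v] of level at least 2.  They are independent
    because a path [v w] occurs in the relation of [v] only. *)
Lemma has_dim_gradeB2 : has_dim (gradeB 2 (F := F) (G := G)) (#|E_ G 2| - 1).
Proof.
pose Q := {v : Vplus G | (1 < level (val v))%N}.
pose r (q : Q) : seq (Vplus G) * Vplus G * seq (Vplus G) := ([::], val q, [::]).
have := @has_dim_gradeB F G 2 Q r; set A := (\matrix_(i, j) _).
have -> : \rank A = #|{: Q}|.
  apply/eqP; rewrite -/(row_free A) -kermx_eq0; apply/rowV0P => y; rewrite sub_kermx.
  move/eqP=> yA; apply/rowP => i; rewrite mxE.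
  have q1 := valP (enum_val i); set q := val (enum_val i) in q1 *.
  have [w qw] := dagger_out (ltnW q1).
  have w0 : (0 < level w)%N by move: q1; rewrite /= (adj_level qw).
  have st : sorted (@adjV G) [tuple q; (Sub w w0 : Vplus G)] by rewrite /= andbT.
  have /rowP/(_ (enum_rank (Sub [tuple q; (Sub w w0 : Vplus G)] st : path_tuple G 2))) := yA.
  rewrite mxE [RHS]mxE (bigD1 i) //= big1 ?addr0 => [|j ji].
    rewrite mxE enum_rankK (_ : relation_row _ _) ?mulr1 //.
    by apply/existsP; exists (Sub w w0); rewrite /= eqxx andbT.
  rewrite mxE enum_rankK; have [/existsP[w' /= /andP[_ /eqP[jq _]]]|_] := boolP (relation_row _ _);
    last by rewrite mulr0.
  by case/eqP: ji; apply/enum_val_inj/val_inj/esym.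
rewrite card_path_tuple2 (card_Vplus_level (p := fun i => (1 < i)%N)) //= mul0n mul1n add0n.
rewrite (addnC _ n2) subnDl; apply=> [q|]; first by split=> //; exact: (valP q).
move=> [|//] v w [|//] v1 _ _; by exists (Sub v v1 : Q).
Qed.

(** Connectedness of the bipartite graph between layers 2 and 1: down-up sequences
    join any two vertices of layer 2, and [Y] takes opposite values at the ends of
    each of their edges. *)
Lemma layer2_constant (V : zmodType) (Y : G -> V) :
    (forall b c, adj b c -> level b = 2%N -> Y b + Y c = 0) ->
  forall b b', level b = 2%N -> level b' = 2%N -> Y b = Y b'.
Proof.
move=> Y0 b b' b2 b'2; have [a [a3 aU aE]] := dagger_top.
have /existsP[e /andP[/eqP ea /eqP eb]] : adj (val a) b by rewrite aE b2.
have /existsP[e' /andP[/eqP e'a /eqP e'b]] : adj (val a) b' by rewrite aE b'2.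
case: dG => -[/(_ e e')]; rewrite ea e'a => /(_ erefl)[k [v [w]]].
rewrite eb e'b b2 => -[<- <- [lv lw vw] _] _ _ _ _ _.
suffices YE j : (j <= k)%N -> Y (v 0%N) = Y (v j) by apply: YE.
elim: j => [//|j IHj] jk; rewrite IHj 1?ltnW //.
have [|v1 v2] := vw j.+1; first by rewrite jk.
have w1 : (level (w j.+1)).+1 = 2%N by apply: lw; rewrite jk.
have := Y0 _ _ (above_adj v1 _) (lv _ _); rewrite /= w1 lv ?(ltnW jk) // => /(_ erefl isT).
have := Y0 _ _ (above_adj v2 _) (lv _ jk); rewrite /= w1 lv // => /(_ erefl) <-.
by move/addIr.
Qed.

(** The equation for [d] is stated without subtraction, so that it contains the
    inequality [n1 + n2 <= #|E_ G 2| + 1]. *)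
Lemma has_dim_gradeB3 : exists d : nat, [/\ has_dim (gradeB 3 (F := F) (G := G)) d
  & (d + (n1 + n2) = #|E_ G 2| + 1)%N].
Proof.
have [a [a3 aU aE]] := dagger_top.
(* A vertex [b] of layer 2 gives the relation [a * b * \sum_c c], and a vertex [c]
   of layer 1 the relation [a * (\sum_b b) * c]. *)
pose Q := {v : Vplus G | (0 < level (val v) < 3)%N}.
have cardQ : #|{: Q}| = (n1 + n2)%N.
  by rewrite (card_Vplus_level (p := fun i => (0 < i < 3)%N)) //= !mul1n addn0.
pose r (q : Q) : seq (Vplus G) * Vplus G * seq (Vplus G) :=
  if level (val (val q)) == 2%N then ([:: a], val q, [::]) else ([::], a, [:: val q]).
have := @has_dim_gradeB F G 3 Q r; set A := (\matrix_(i, j) _) => dimB.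
(* The vector [y], regarded as a function on all vertices. *)
pose Y (y : 'rV[F]_#|{: Q}|) (v : G) := \sum_(i | val (val (enum_val i)) == v) y 0 i.
have YE y i : Y y (val (val (enum_val i))) = y 0 i.
  by rewrite /Y (big_pred1 i) // => j; rewrite !val_eqE (inj_eq enum_val_inj).
(* The relation matrix is the incidence matrix of the bipartite graph. *)
have AE (i : 'I_#|{: Q}|) (x b c : Vplus G) : sorted (@adjV G) [:: x; b; c] ->
    relation_row (r (enum_val i)) [:: x; b; c] =
      (val (val (enum_val i)) == val b) || (val (val (enum_val i)) == val c).
  move=> st; have [xb bc /aU/val_inj xa b2 c1] := path3P st; subst x.
  rewrite /relation_row /r !val_eqE; set q := val (enum_val i).
  have [q2|q2] := eqVneq.
    have -> : (q == c) = false by apply/eqP => E; rewrite E c1 in q2.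
    rewrite orbF /=; apply/existsP/eqP => [[w /andP[_ /eqP[-> _]]] //|->].
    by exists c; rewrite eqxx andbT.
  have -> : (q == b) = false by apply/eqP => E; rewrite E b2 in q2.
  rewrite /=; apply/existsP/eqP => [[w /andP[_ /eqP[_ ->]]] //|->].
  by exists b; rewrite eqxx andbT.
have mulA y t : (y *m A) 0 (enum_rank t) =
    Y y (val (nth a (val t) 1)) + Y y (val (nth a (val t) 2)).
  case: t => -[[|x [|b [|c [|]]]] // sz] st; rewrite mxE /=.
  have [_ _ _ b2 c1] := path3P st.
  rewrite /Y [X in X + _]big_mkcond [X in _ + X]big_mkcond -big_split.
  apply: eq_bigr => i _ /=; rewrite mxE enum_rankK /= AE //.
  have [ib|_] := eqVneq (val (val (enum_val i))) (val b); last first.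
    by case: eqP; rewrite add0r ?mulr1 ?mulr0.
  by rewrite ifN ?addr0 ?mulr1 // ib; apply/eqP => E; move: b2; rewrite E c1.
have yA_eq y : y *m A = 0 <-> forall b c, adj b c -> level b = 2%N -> Y y b + Y y c = 0.
  split=> [yA b c bc b2|Y0].
    have b0 : (0 < level b)%N by rewrite b2.
    have c0 : (0 < level c)%N by have := adj_level bc; rewrite b2 => -[<-].
    have st : sorted (@adjV G) [tuple a; (Sub b b0 : Vplus G); Sub c c0].
      by rewrite /= andbT /adjV /= aE b2 eqxx.
    have := mulA y (Sub [tuple a; (Sub b b0 : Vplus G); Sub c c0] st).
    by rewrite yA mxE.
  apply/rowP => j; rewrite -[j]enum_valK mulA mxE.
  case: (enum_val j) => -[[|x [|b [|c [|]]]] // sz] st /=.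
  by have [_ bc _ b2 _] := path3P st; apply: Y0.
have /card_gt0P[b0] := layer2_neq0; rewrite inE => /eqP b02.
(* The left kernel is spanned by the vector of signs of the two layers. *)
pose z : 'rV[F]_#|{: Q}| :=
  \row_i (if level (val (val (enum_val i))) == 2%N then 1 else - 1).
have level_Q (q : Q) : level (val (val q)) = 2%N \/ level (val (val q)) = 1%N.
  by have := valP q => /=; case: (level _) => [|[|[|]]] //; [right|left].
have inQ (v : G) : (0 < level v < 3)%N -> exists i : 'I_#|{: Q}|, val (val (enum_val i)) = v.
  move=> v03; have v0 : (0 < level v)%N by case/andP: v03.
  by exists (enum_rank (Sub (Sub v v0 : Vplus G) v03 : Q)); rewrite enum_rankK.
have z0 : z != 0.
  have [|i ib0] := inQ b0; first by rewrite b02.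
  by apply/eqP => /rowP/(_ i); rewrite !mxE ib0 b02 eqxx; apply/eqP/oner_neq0.
have zA : z *m A = 0.
  apply/yA_eq => b c bc b2; have c1 : level c = 1%N by have := adj_level bc; rewrite b2 => -[].
  have [|i ib] := inQ b; first by rewrite b2.
  have [|j jc] := inQ c; first by rewrite c1.
  by rewrite -ib -jc !YE !mxE ib jc b2 c1 /= subrr.
have kerA (y : 'rV_#|{: Q}|) : y *m A = 0 -> (y <= z)%MS.
  move/yA_eq => Y0; have Yb := layer2_constant Y0.
  suffices -> : y = Y y b0 *: z by apply: scalemx_sub.
  apply/rowP => i; rewrite !mxE -YE; have [i2|i1] := level_Q (enum_val i).
    by rewrite i2 eqxx mulr1; apply: Yb.
  rewrite i1 mulrN1; have [|b bi] := @dagger_in (val (val (enum_val i))); first by rewrite i1.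
  have b2 : level b = 2%N by rewrite (adj_level bi) i1.
  by rewrite (Yb b0 b) //; apply/eqP; rewrite -addr_eq0 addrC Y0.
have rkA := mxrank_ker_line z0 zA kerA.
have := rank_leq_col A; rewrite rkA card_path_tuple3 cardQ => leE.
exists (#|E_ G 2| - (n1 + n2).-1)%N; split; last by have := layer1_neq0; lia.
rewrite -cardQ -rkA -card_path_tuple3; apply: dimB => [q|].
  rewrite /r; case: (level_Q q) => q12; by rewrite q12 /= ?a3 ?q12.
move=> s1 v w s2 v1 sz st.
move: s1 s2 sz st => [|x [|? ?]] [|y [|? ?]] //=; rewrite ?addnS // => _ st.
  have [_ _ /aU/val_inj va _ y1] := path3P st.
  have y03 : (0 < level (val y) < 3)%N by rewrite y1.
  by exists (Sub y y03 : Q); rewrite /r /= y1 va.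
have [_ _ /aU/val_inj xa v2 _] := path3P st.
have v03 : (0 < level (val v) < 3)%N by rewrite v2.
by exists (Sub v v03 : Q); rewrite /r /= v2 xa.
Qed.

End DaggerGraphs.

(** * Hilbert series and bounds *)

Lemma dagger_hilbert_series (F : fieldType) (G : layeredGraph) :
    dagger G -> maximal_in_top G ->
    let r : int := #|{: Vplus G}|%:Z in
    let s : int := #|E_ G 2|%:Z - 1 in
  hilbert_series_is F G (1 + r *: 'X + s *: 'X^2 + (s - r + 3) *: 'X^3).
Proof.
move=> dG mG r s n.
rewrite !coefD !coefZ coef1 coefX !coefXn.
have [d3 [dim3 d3E]] := has_dim_gradeB3 F dG mG.
have n1_gt0 := layer1_neq0 dG; have n2_gt0 := layer2_neq0 dG.
have rE := card_Vplus dG.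
case: n => [|[|[|[|n]]]] /=.
- exists #|{: path_tuple G 0}|; first exact: has_dim_gradeB_free.
  by rewrite path_tuple_small // expn0 /=; lia.
- exists #|{: path_tuple G 1}|; first exact: has_dim_gradeB_free.
  by rewrite path_tuple_small // expn1 /r /=; lia.
- exists (#|E_ G 2| - 1)%N; first exact: has_dim_gradeB2.
  by rewrite /s /=; lia.
- exists d3 => //; rewrite /s /r rE /=; lia.
exists #|{: path_tuple G n.+4}|; last by rewrite path_tuple_large //; lia.
apply: has_dim_gradeB_free => s1 v w s2 _ sz; apply/negP => st.
have sz' : size (s1 ++ [:: v, w & s2]) == n.+4 by rewrite size_cat /= !addnS sz.
have := path_tuple_large dG (isT : (3 < n.+4)%N).
by move=> /card0_eq/(_ (Sub (Tuple sz') st)); rewrite inE.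
Qed.

Lemma dagger_bounds (G : layeredGraph) :
    dagger G -> maximal_in_top G ->
    let r : int := #|{: Vplus G}|%:Z in
    let s : int := #|E_ G 2|%:Z - 1 in
  [/\ 3 <= r, r - 3 <= s & s%:~R <= - 1 + (r%:~R - 1) ^+ 2 / 4 :> rat].
Proof.
move=> dG mG r s; rewrite /r /s card_Vplus //.
(* Any field serves to bound the number of edges from below. *)
have [d3 [_ d3E]] := has_dim_gradeB3 rat dG mG.
have n1_gt0 := layer1_neq0 dG; have n2_gt0 := layer2_neq0 dG.
have E_le := card_E2_le dG.
split; [lia|lia|].
move: E_le; rewrite -(ler_nat rat) natrM !rmorphB /= !PoszD !rmorphD /= -!pmulrn.
set x := #|layer G 1|%:R; set y := #|layer G 2|%:R; set e := #|_|%:R => E_le.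
have : 0 <= (x - y) ^+ 2 by exact: sqr_ge0.
nra.
Qed.

(** * Construction of graphs of type dagger *)

Lemma exists_subset_card (T : finType) (B : {set T}) k :
  (k <= #|B|)%N -> exists2 C : {set T}, C \subset B & #|C| = k.
Proof.
move=> kB; exists [set x in take k (enum B)].
  by apply/subsetP => x; rewrite inE => /mem_take; rewrite mem_enum.
rewrite cardsE (card_uniqP _) ?take_uniq ?enum_uniq //.
by rewrite size_take -cardE; case: ltngtP kB.
Qed.

Section BipartiteLayers.

Variables (p q : nat) (A : {set 'I_p.+1 * 'I_q.+1}).

Definition bip_vertex := option (option ('I_p.+1 + 'I_q.+1)).

Definition bip_top : bip_vertex := None.
Definition bip_bottom : bip_vertex := Some None.
Definition bip_up (i : 'I_p.+1) : bip_vertex := Some (Some (inl i)).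
Definition bip_down (j : 'I_q.+1) : bip_vertex := Some (Some (inr j)).

Definition bip_adj (u v : bip_vertex) : bool :=
  match u, v with
  | None, Some (Some (inl _)) => true
  | Some (Some (inl i)), Some (Some (inr j)) => (i, j) \in A
  | Some (Some (inr _)), Some None => true
  | _, _ => false
  end.

Definition bip_level (v : bip_vertex) : nat :=
  match v with
  | None => 3
  | Some None => 0
  | Some (Some (inl _)) => 2
  | Some (Some (inr _)) => 1
  end.

Definition bip_edge := {uv : bip_vertex * bip_vertex | bip_adj uv.1 uv.2}.

Lemma bip_level_src (e : bip_edge) : bip_level (val e).1 = (bip_level (val e).2).+1.
Proof. by case: e => -[[[[i|j]|]|] [[[i'|j']|]|]]. Qed.

Definition bip_graph : layeredGraph :=
  @LayeredGraph bip_vertex bip_edge (fun e => (val e).1) (fun e => (val e).2)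
    bip_level bip_level_src.

Lemma bip_graph_adj (u v : bip_graph) : adj u v = bip_adj u v.
Proof.
apply/existsP/idP => [[e /andP[/eqP <- /eqP <-]]|uv]; first exact: (valP e).
by exists (Sub (u, v) uv : bip_edge); rewrite /= !eqxx.
Qed.

Lemma bip_graph_no_multiple_edges : no_multiple_edges bip_graph.
Proof. by move=> [[u v] uv] [[u' v'] uv'] E; apply: val_inj. Qed.

(* [A] contains the double star centred at the first vertices of both layers. *)
Hypothesis star : forall i j, (i == ord0) || (j == ord0) -> (i, j) \in A.

Lemma bip_minimal (v : bip_graph) : minimal v <-> v = bip_bottom.
Proof.
split=> [vmin|->]; last exact: level0_minimal.
have no_adj w : ~~ @adj bip_graph v w by apply/negP => /adj_above/vmin.
case: v vmin no_adj => [[[i|j]|]|] // _ no_adj.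
- by have := no_adj (bip_down ord0); rewrite bip_graph_adj /= star ?orbT.
- by have := no_adj bip_bottom; rewrite bip_graph_adj.
by have := no_adj (bip_up ord0); rewrite bip_graph_adj.
Qed.

Lemma bip_maximal : maximal_in_top bip_graph.
Proof.
move=> v vmax; have no_adj w : ~~ @adj bip_graph w v by apply/negP => /adj_above/vmax.
case: v vmax no_adj => [[[i|j]|]|] // _ no_adj.
- by have := no_adj bip_top; rewrite bip_graph_adj.
- by have := no_adj (bip_up ord0); rewrite bip_graph_adj /= star.
by have := no_adj (bip_down ord0); rewrite bip_graph_adj.
Qed.

(** Two heads are joined through one vertex: the bottom one if they are in layer 1,
    and the centre of layer 1 if they are in layer 2. *)
Lemma bip_uniform : uniform bip_graph.
Proof.
move=> e e'; case: e e' => -[u v] uv [[u' v'] uv'] /= E; subst u'.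
have [vv'|nvv'] := eqVneq v v'.
  exists 0%N, (fun _ => v), (fun _ => v); split => // [|j _].
    by split=> // j; case: j.
  by apply: adj_above; rewrite bip_graph_adj.
exists 1%N, (fun j => if j == 0%N then v else v'),
  (fun _ => if u is None then bip_down ord0 else bip_bottom); split=> //.
  split=> j.
  - by case: u v v' uv uv' {nvv'} => [[[?|?]|]|] [[[?|?]|]|] // [[[?|?]|]|] //; case: eqP.
  - by case: u v v' uv uv' nvv' => [[[?|?]|]|] [[[?|?]|]|] // [[[?|?]|]|].
  case: j => [|[|]] //= _; split; apply: adj_above; rewrite bip_graph_adj.
    by case: u v v' uv uv' nvv' => [[[?|?]|]|] [[[?|?]|]|] // [[[?|?]|]|] //= *;
      rewrite star ?eqxx ?orbT.
  by case: u v v' uv uv' nvv' => [[[?|?]|]|] [[[?|?]|]|] // [[[?|?]|]|] //= *;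
    rewrite star ?eqxx ?orbT.
by move=> j _; apply: adj_above; rewrite bip_graph_adj; case: eqP.
Qed.

Lemma bip_dagger : dagger bip_graph.
Proof.
split.
- split; [exact: bip_uniform|exact: bip_graph_no_multiple_edges].
- by case=> [[[i|j]|]|].
- exists bip_bottom; split=> [|v]; first exact/bip_minimal.
  by move/bip_minimal.
- by move=> v /bip_minimal ->.
exists bip_top; first by case=> [[[i|j]|]|].
by case=> [[[i|j]|]|] // _; apply: adj_above; rewrite bip_graph_adj.
Qed.

Lemma bip_card_Vplus : #|{: Vplus bip_graph}| = (p + q + 3)%N.
Proof.
have := cardC (pred1 (bip_bottom : bip_graph)); rewrite card1 => E.
rewrite card_sig (_ : (p + q + 3)%N = #|bip_graph| - 1)%N; last first.
  by rewrite !card_option card_sum !card_ord; lia.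
by rewrite -E addKn; apply: eq_card => -[[[i|j]|]|].
Qed.

Lemma bip_card_E2 : #|E_ bip_graph 2| = #|A|.
Proof.
rewrite card_E_adj; last exact: bip_graph_no_multiple_edges.
pose f (ij : 'I_p.+1 * 'I_q.+1) : bip_graph * bip_graph := (bip_up ij.1, bip_down ij.2).
have f_inj : injective f by move=> [i j] [i' j'] [-> ->].
rewrite -(card_imset _ f_inj); apply: eq_card => -[u v].
rewrite inE bip_graph_adj /=; apply/andP/imsetP => [|[[i j] ijA [-> ->]]]; last by [].
case: u v => [[[i|j]|]|] [[[i'|j']|]|] [] //= ijA _.
by exists (i, j').
Qed.

End BipartiteLayers.

(** The double star has [p + q + 1] edges; [rest] consists of the other pairs. *)
Lemma exists_dagger (p q k : nat) :
    (p + q + 1 <= k <= p.+1 * q.+1)%N ->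
  exists G : layeredGraph, [/\ dagger G, maximal_in_top G,
    #|{: Vplus G}| = (p + q + 3)%N & #|E_ G 2| = k].
Proof.
case/andP=> k_ge k_le.
pose rest : {set 'I_p.+1 * 'I_q.+1} := setX [set~ ord0] [set~ ord0].
have card_rest : #|rest| = (p * q)%N by rewrite cardsX !cardsC1 !card_ord.
have [|C Crest cardC] := @exists_subset_card _ rest (k - (p + q + 1)).
  by rewrite card_rest; nia.
pose A := ~: rest :|: C.
have star i j : (i == ord0) || (j == ord0) -> (i, j) \in A.
  by rewrite !inE => /orP[]/eqP ->; rewrite eqxx ?andbF.
exists (bip_graph A); split.
- exact: bip_dagger.
- exact: bip_maximal.
- exact: bip_card_Vplus.
rewrite bip_card_E2 cardsU (_ : _ :&: C = set0) ?cards0 ?subn0.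
  by rewrite cardsCs setCK card_rest cardC card_prod !card_ord; nia.
by apply/eqP; rewrite setI_eq0 disjoints_subset setCS.
Qed.

Theorem mainTheorem5 (F : fieldType) :
  (forall G : layeredGraph, dagger G -> maximal_in_top G ->
     let r : int := #|{: Vplus G}|%:Z in
     let s : int := #|E_ G 2|%:Z - 1 in
     [/\ 3 <= r,
         r - 3 <= s,
         (s%:~R <= - 1 + (r%:~R - 1) ^+ 2 / 4 :> rat)
       & hilbert_series_is F G
           (1 + r *: 'X + s *: 'X^2 + (s - r + 3) *: 'X^3)])
  /\
  (forall r s : int,
     3 <= r -> r - 3 <= s ->
     (s%:~R <= - 1 + (r%:~R - 1) ^+ 2 / 4 :> rat) ->
     exists G : layeredGraph,
       [/\ dagger G,
           maximal_in_top G,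
           r = #|{: Vplus G}|%:Z
         & s = #|E_ G 2|%:Z - 1]).
Proof.
split=> [G dG mG r s|r s r3 rs s_le].
  by have [? ? ?] := dagger_bounds dG mG; split=> //; exact: dagger_hilbert_series.
(* The upper bound with its denominator cleared, as an inequality of integers. *)
have s_le' : s * 4 + 4 <= (r - 1) ^+ 2.
  rewrite -(ler_int rat) rmorphD rmorphM rmorphXn rmorphB /= -!pmulrn.
  lra.
have [m rE] : exists m, r = m%:Z + 3 by exists `|r - 3|%N; lia.
have [k sE] : exists k, s = k%:Z - 1 by exists `|(s + 1)%R|%N; lia.
subst r s.
have [|G [dG mG VG EG]] := @exists_dagger m./2 (m - m./2) k.
  by move: s_le'; have := odd_double_half m; case: (odd m); nia.
exists G; split=> //; last by rewrite EG.
by rewrite VG; have := odd_double_half m; lia.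
Qed.
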